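(* Let $k\geq 1$, let $P_{2k+1}$ be the path with $2k+1$ vertices and let $H$ be a graph. Then the lexicographic product $P_{2k+1}[H]$ is pancyclic if and only if $\pi(H)\geq 1$ and $\left\lceil \frac{|H|}{\pi(H)}\right\rceil\leq k+1$.
   Context: The lexicographic product $G[H]$ has vertex set $V(G)\times V(H)$, with $(g,h)(g',h')$ an edge iff $gg'\in E(G)$, or $g=g'$ and $hh'\in E(H)$. $|H|$ is the number of vertices of $H$. $\pi(H)$ is the maximum number of edges of a spanning linear forest of $H$ (a forest whose components are paths). A graph on $N$ vertices is pancyclic if it contains cycles of every length from $3$ to $N$. *)

(* Defs.v *)
From HB Require Import structures.
From mathcomp Require Import all_boot all_order all_algebra.

Set Implicit Arguments.
Unset Strict Implicit.
Unset Printing Implicit Defensive.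

Record sgraph := SGraph {
  vertex :> finType;
  adj : rel vertex;
  adj_sym : symmetric adj;
  adj_irr : irreflexive adj }.

Definition edges (G : sgraph) : {set {set G}} :=
  [set e | [exists x : G, exists y : G, adj x y && (e == [set x; y])]].

(* Graph isomorphism, as a boolean: mutually inverse maps f and g, with f
   preserving and reflecting adjacency. *)
Definition isomorphic (G H : sgraph) : bool :=
  [exists f : {ffun G -> H}, exists g : {ffun H -> G},
    [&& [forall x, g (f x) == x], [forall y, f (g y) == y]
      & [forall x, forall y, adj (f x) (f y) == adj x y]]].

Definition path_adj n : rel 'I_n :=
  fun i j => (i.+1 == j :> nat) || (j.+1 == i :> nat).

Fact path_adj_sym n : symmetric (@path_adj n).
Proof. by move=> i j; rewrite /path_adj orbC. Qed.

Fact path_adj_irr n : irreflexive (@path_adj n).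
Proof. by move=> i; rewrite /path_adj orbb gtn_eqF. Qed.

Definition pathG n : sgraph := SGraph (@path_adj_sym n) (@path_adj_irr n).

Definition lex_adj (G H : sgraph) : rel (G * H) :=
  fun u v => adj u.1 v.1 || (u.1 == v.1) && adj u.2 v.2.

Fact lex_adj_sym (G H : sgraph) : symmetric (@lex_adj G H).
Proof.
by move=> u v; rewrite /lex_adj adj_sym (adj_sym u.2) (eq_sym u.1).
Qed.

Fact lex_adj_irr (G H : sgraph) : irreflexive (@lex_adj G H).
Proof. by move=> u; rewrite /lex_adj !adj_irr andbF. Qed.

Definition lexprod (G H : sgraph) : sgraph :=
  SGraph (@lex_adj_sym G H) (@lex_adj_irr G H).

Definition has_cycle (G : sgraph) (l : nat) : bool :=
  (2 < l) && [exists c : l.-tuple G, ucycleb (@adj G) c].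

Definition pancyclic (G : sgraph) : Prop :=
  forall l : nat, 3 <= l <= #|G| -> has_cycle G l.

Definition induced_adj (G : sgraph) (A : {set G}) : rel {x : G | x \in A} :=
  fun u v => adj (val u) (val v).

Fact induced_adj_sym (G : sgraph) (A : {set G}) : symmetric (induced_adj (A := A)).
Proof. by move=> u v; apply: adj_sym. Qed.

Fact induced_adj_irr (G : sgraph) (A : {set G}) : irreflexive (induced_adj (A := A)).
Proof. by move=> u; apply: adj_irr. Qed.

Definition induced (G : sgraph) (A : {set G}) : sgraph :=
  SGraph (@induced_adj_sym G A) (@induced_adj_irr G A).

Definition component (G : sgraph) (x : G) : sgraph :=
  induced [set y | connect (@adj G) x y].

(* A cycle has no repeated vertex, so only lengths l <= #|G| can occur. *)
Definition forest (G : sgraph) : bool :=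
  [forall l : 'I_#|G|.+1, ~~ has_cycle G l].

(* One-vertex components count as paths. *)
Definition linear_forest (G : sgraph) : bool :=
  forest G &&
  [forall x : G, isomorphic (component x) (pathG #|component x|)].

Definition spanning_adj (G : sgraph) (F : {set {set G}}) : rel G :=
  fun x y => (x != y) && ([set x; y] \in F).

Fact spanning_adj_sym (G : sgraph) (F : {set {set G}}) : symmetric (spanning_adj F).
Proof. by move=> x y; rewrite /spanning_adj eq_sym setUC. Qed.

Fact spanning_adj_irr (G : sgraph) (F : {set {set G}}) : irreflexive (spanning_adj F).
Proof. by move=> x; rewrite /spanning_adj eqxx. Qed.

(* The graph (V(G), F); it is a spanning subgraph of G when F is a subset of
   edges G, and its edge set is then F. *)
Definition spanning (G : sgraph) (F : {set {set G}}) : sgraph :=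
  SGraph (spanning_adj_sym F) (spanning_adj_irr F).

(* The maximum number of edges of a spanning linear forest; F = set0 always
   qualifies, so the maximum is over a nonempty family. *)
Definition pi_graph (G : sgraph) : nat :=
  \max_(F : {set {set G}} | (F \subset edges G) && linear_forest (spanning F))
    #|F|.

(* Main.v *)
Require Import Defs.
From HB Require Import structures.
From mathcomp Require Import all_boot all_order all_algebra.
From mathcomp Require Import zify.

(* pi(H) is the largest number of adjacent consecutive pairs in an ordering of
   V(H).  Write n = |H|, p = pi(H); the condition reads n <= (k+1) p.

   Necessity: in a Hamiltonian cycle, the vertices in the k+1 even layers form
   maximal runs, each inside one layer, separated by the kn vertices in odd
   layers.  Hence there are at most kn runs, so at least (k+1)n - kn edges lie
   inside even layers, and each layer contains at most p of them.

   Sufficiency: a closed walk on the path visiting layer i exactly a_i times,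
   with n - p <= a_i <= n, blows up to a Hamiltonian cycle by replacing the
   visits to layer i by the a_i paths of a linear forest of H.  Truncating these
   paths gives every length down to that of the walk; for smaller lengths the
   walk itself is shortened, which frees a vertex in some visited layer, so that
   one visit there may be replaced by an edge to obtain odd lengths. *)

Set Implicit Arguments.
Unset Strict Implicit.
Unset Printing Implicit Defensive.

(** * Closed walks on a path with prescribed numbers of visits *)

Definition stepn : rel nat := fun i j => (i.+1 == j) || (j.+1 == i).

(* A closed walk at [s], without its initial [s], that steps back and forth
   [nth 0 f i] times between [s + i] and [s + i + 1] (for positive entries). *)
Fixpoint tour (s : nat) (f : seq nat) : seq nat :=
  if f is x :: f' then
    s.+1 :: tour s.+1 f' ++ s :: flatten (nseq x.-1 [:: s.+1; s])
  else [::].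

Lemma path_tour s f : path stepn s (tour s f) /\ last s (tour s f) = s.
Proof.
elim: f s => [|x f IH] s //=.
have [pt lt] := IH s.+1.
have bf y : path stepn s (flatten (nseq y [:: s.+1; s])) /\
            last s (flatten (nseq y [:: s.+1; s])) = s.
  elim: y => [|y [py ly]] //=; split=> //.
  by rewrite py /stepn !eqxx orbT.
have [pb lb] := bf x.-1.
by rewrite cat_path last_cat /= lt pt pb lb /stepn !eqxx orbT.
Qed.

Lemma cycle_tour s f : cycle stepn (tour s f).
Proof. by rewrite (cycle_path s); have [p ->] := path_tour s f. Qed.

(** An entry [x] accounts for [x] steps out and [x] back. Positivity matters: an entry 0 would still
    cost one excursion. *)
Lemma size_tour s f : all (leq 1) f -> size (tour s f) = (sumn f).*2.
Proof.
elim: f s => [|x f IH] s //= /andP[x0 /IH{}IH].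
rewrite size_cat /= IH size_flatten /shape map_nseq sumn_nseq /=; lia.
Qed.

(** Layer [i] is entered from the right [nth 0 f (i - s)] times and from the left as often as the
    preceding entry says. The shifted list [0 :: f] supplies that entry; its head and the default 0
    handle the two ends. *)
Lemma count_tour i s f : all (leq 1) f ->
  count_mem i (tour s f) =
    if s <= i then nth 0 f (i - s) + nth 0 (0 :: f) (i - s) else 0.
Proof.
elim: f s => [|x f IH] s /=.
  by rewrite nth_nil; case: (i - s) => [|d] /=; rewrite ?nth_nil if_same.
move=> /andP[x0 f0]; rewrite count_cat /= IH // count_flatten map_nseq sumn_nseq /=.
have [/eqP ->|si] := boolP (i == s); first by rewrite ltnn leqnn subnn /= eqxx gtn_eqF //=; lia.
have [/eqP ->|si1] := boolP (i == s.+1).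
  by rewrite leqnn leqnSn subnn subSn // subnn /= !eqxx ltn_eqF //=; lia.
rewrite (eq_sym s.+1) (eq_sym s) (negbTE si) (negbTE si1) /=.
case: (ltnP s i) => [lt|ge]; last by rewrite ifF; lia.
have -> : i - s = (i - s.+1).+1 by lia.
rewrite (ltnW lt) /=; case E : (i - s.+1) => [|d] /=; lia.
Qed.

Lemma tour_range s f : all (fun i => s <= i <= s + size f) (tour s f).
Proof.
elim: f s => [|x f IH] s //=.
rewrite all_cat /=; apply/and4P; split; [lia| |lia|].
  by apply: sub_all (IH s.+1) => i /=; lia.
by elim: (x.-1) => //= y ->; rewrite andbT; lia.
Qed.

(** Entries are used up from the left: the first one is lowered if [t] exceeds the sum of the
    others, and otherwise dropped, which moves the start to [s.+1]. The strict drop at a visited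
    layer later makes room for odd lengths. *)
Lemma shrink_tour f s t : all (leq 1) f -> 0 < t < sumn f ->
  exists s' f', [/\ all (leq 1) f', sumn f' = t, s' + size f' = s + size f,
   (forall i, count_mem i (tour s' f') <= count_mem i (tour s f)) &
   exists2 j, j \in tour s' f' & count_mem j (tour s' f') < count_mem j (tour s f)].
Proof.
elim: f s => [|x f IH] s /=; first by lia.
move=> /andP[x0 f0] /andP[t0 tlt].
have mono s' f' i : i \in tour s' f' = (0 < count_mem i (tour s' f')) by rewrite -has_count has_pred1.
have big i : count_mem i (tour s.+1 f) + (i == s.+1) <= count_mem i (tour s (x :: f)).
  by rewrite /= count_cat /= eq_sym; lia.
case: (ltngtP t (sumn f)) => [lt|gt|E].
- have [s' [f' [h1 h2 h3 h4 [j h5 h6]]]] := IH s.+1 f0 (introT andP (conj t0 lt)).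
  exists s', f'; split=> //; first by lia.
    by move=> i; apply: leq_trans (h4 i) (leq_trans (leq_addr _ _) (big i)).
  by exists j => //; apply: leq_trans h6 (leq_trans (leq_addr _ _) (big j)).
- exists s, ((t - sumn f) :: f); have h : all (leq 1) ((t - sumn f) :: f) by rewrite /= f0; lia.
  have hx : all (leq 1) (x :: f) by rewrite /= f0 x0.
  split=> //=; [lia| |].
    move=> i; rewrite -/(tour s (_ :: f)) -/(tour s (x :: f)).
    have := count_tour i s h; have := count_tour i s hx; rewrite /= => -> ->.
    by case: ifP => // _; case: (i - s) => [|[|d]] /=; lia.
  have := count_tour s s h; have := count_tour s s hx.
  rewrite /= leqnn subnn /= => e1 e2.
  exists s; last by rewrite e1 e2; lia.
  by rewrite -has_pred1 has_count /= e2; lia.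
- exists s.+1, f; split=> //; first by rewrite /=; lia.
    by move=> i; apply: leq_trans (leq_addr _ _) (big i).
  exists s.+1; last by apply: leq_trans (big s.+1); rewrite eqxx addn1.
  rewrite mono count_tour // leqnn subnn /=.
  by case: f f0 E {IH tlt big} => [|y f] /= => [_ E|/andP[y0 _] _]; lia.
Qed.

(* Multiplicity of the step between layers i and i+1 in the closed walk of the
   Hamiltonian cycle, [m] being the number of paths of the linear forest.  Even
   layers are visited [m] times (2 times if [m = 1]), and the share [x j] of
   layer [2j] that goes to its left grows by at most [p] with [j], so that odd
   layers are visited at most [m + p = |H|] times. *)
Definition mult (k p m i : nat) : nat :=
  let x j := minn (j * p) m.-1 in
  if odd i then if i.+1 == k.*2 then m else maxn 1 (x i./2.+1) else m - x i./2.

(** The hypothesis [m <= k * p] serves layer 2k-1: its share to the right is all of [m], so its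
    share to the left, what remains of [m] after the first k-1 increments, must be at most [p]. *)
Lemma mult_visits k p m i : 0 < k -> 0 < p -> 0 < m -> m <= k * p -> i <= k.*2 ->
  m <= nth 0 (mkseq (mult k p m) k.*2) i +
       nth 0 (0 :: mkseq (mult k p m) k.*2) i <= m + p.
Proof.
move=> k0 p0 m0 mk ik; set f := mkseq _ _.
have fE j : nth 0 f j = if j < k.*2 then mult k p m j else 0.
  by case: ltnP => h; [rewrite nth_mkseq | rewrite nth_default // size_mkseq].
case: i ik => [|i] ik.
  by rewrite /= fE ifT; [rewrite /mult /= mul0n; lia | lia].
rewrite [nth _ (_ :: _) _]/= !fE ik.
(* The layer is now [i.+1], so an odd [i] is the case of an even layer. *)
have [oi|ei] := boolP (odd i).
- have [j ij] : exists j, i = j.*2.+1 by exists i./2; lia.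
  rewrite {i oi}ij in ik *; rewrite /mult /= odd_double /= -doubleS.
  rewrite uphalf_double doubleK.
  have jp : 0 < j.+1 * p by rewrite muln_gt0.
  by case: ltnP => lt; case: eqP => eq; lia.
- have [j ij] : exists j, i = j.*2 by exists i./2; lia.
  rewrite {i ei}ij in ik *; rewrite /mult /= odd_double /= doubleK uphalf_double.
  have E : j.+1 * p = j * p + p by rewrite mulSn addnC.
  rewrite E ifT; last by lia.
  case: eqP => [e|ne]; last by lia.
  have ej : j.+1 = k by lia.
  by rewrite -ej E in mk; lia.
Qed.

Lemma mult_gt0 k p m i : 0 < m -> 0 < mult k p m i.
Proof. by move=> m0; rewrite /mult; case: ifP => _; [case: ifP=> _|]; lia. Qed.

(** * Blowing up a closed walk to cycles of the lexicographic product *)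

Section BlowUp.
Variable H : sgraph.

(** Layers are plain natural numbers, so that walks stay lists over [nat]; [has_cycle_layers]
    returns to [pathG N]. *)
Definition layer_adj : rel (nat * H) :=
  fun u v => stepn u.1 v.1 || (u.1 == v.1) && adj u.2 v.2.

(** A block [(i, q)] is one visit to layer [i], during which the path [q] of [H] is traversed. *)
Definition expand (ss : seq (nat * seq H)) : seq (nat * H) :=
  flatten [seq [seq (x.1, h) | h <- x.2] | x <- ss].

Arguments expand : simpl never.

Lemma expand_cons i q ss :
  expand ((i, q) :: ss) = [seq (i, h) | h <- q] ++ expand ss.
Proof. by []. Qed.

Definition piece (q : seq H) := (q != [::]) && sorted (@adj H) q.

Definition pieces (ss : seq (nat * seq H)) := all (fun x => piece x.2) ss.

Lemma has_cycle_layers N (c : seq (nat * H)) : 2 < size c -> uniq c ->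
  all (fun v => v.1 < N) c -> cycle layer_adj c ->
  has_cycle (lexprod (pathG N) H) (size c).
Proof.
move=> c2 uc cN cc; rewrite /has_cycle c2 /=.
pose g (v : 'I_N * H) : nat * H := (val v.1, v.2).
have [c' Ec] : exists c', map g c' = c.
  elim: c cN {c2 uc cc} => [|[i h] c IH] /=; first by exists [::].
  move=> /andP[iN /IH[c' <-]]; by exists ((Ordinal iN, h) :: c').
have ig : injective g by case=> [i h] [j h'] [] /val_inj -> ->.
have sc : size c' == size c by rewrite -Ec size_map.
apply/existsP; exists (Tuple sc); rewrite /ucycleb /=.
rewrite -(map_inj_uniq ig) Ec uc andbT.
by rewrite -Ec cycle_map in cc; apply: etrans cc; apply: eq_cycle.
Qed.

Lemma size_expand ss : pieces ss -> size ss <= size (expand ss).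
Proof.
elim: ss => [|[i q] ss IH] //= /andP[/andP[/= q0 _] /IH {}IH].
by rewrite expand_cons size_cat size_map; case: q q0 => //= h q _; lia.
Qed.

Lemma ltn_size_expand ss x : pieces ss -> x \in ss -> 1 < size x.2 ->
  size ss < size (expand ss).
Proof.
elim: ss => [|[i q] ss IH] //= /andP[/andP[/= q0 _] ps].
have := size_expand ps; rewrite in_cons expand_cons size_cat size_map => le /orP[/eqP ->|xs] x2.
  by rewrite /= in x2; lia.
by have := IH ps xs x2; case: q q0 => //= h q _; lia.
Qed.

(** The vertex [h] is arbitrary because a step between neighbouring layers ignores the second
    coordinate; [expand_cycle] uses this to close the walk at its last vertex. *)
Lemma expand_path ss i h : pieces ss -> path stepn i (unzip1 ss) ->
  path layer_adj (i, h) (expand ss) /\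
  (last (i, h) (expand ss)).1 = last i (unzip1 ss).
Proof.
elim: ss i h => [|[j q] ss IH] i h //= /andP[/andP[/= q0 sq] ps] /andP[ij pj].
rewrite expand_cons cat_path last_cat.
case: q q0 sq => //= h' q _ pq.
have -> : path layer_adj (j, h') [seq (j, h) | h <- q].
  rewrite path_map; apply: sub_path pq => a b /= ab.
  by rewrite /layer_adj /= eqxx ab orbT.
rewrite {1}/layer_adj /= ij /=.
by rewrite last_map; apply: IH.
Qed.

Lemma expand_cycle ss : pieces ss -> cycle stepn (unzip1 ss) ->
  cycle layer_adj (expand ss).
Proof.
move=> ps; move: (@expand_path ss).
case E : (expand ss) => // [[i h] c] H1.
have : unzip1 ss != [::] by case: ss E {ps H1}.
rewrite (cycle_path i) => w0 pw.
have [p1 l1] := H1 _ h ps pw.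
rewrite (cycle_path (i, h)) /=; rewrite /= in l1.
have El : last (i, h) c = (last i (unzip1 ss), (last (i, h) c).2).
  by rewrite [LHS]surjective_pairing l1; case: (unzip1 ss) w0.
by rewrite El; case: (H1 _ (last (i, h) c).2 ps pw).
Qed.

Lemma truncate ss L : pieces ss -> size ss <= L <= size (expand ss) ->
  exists ss', [/\ unzip1 ss' = unzip1 ss, pieces ss',
    subseq (expand ss') (expand ss) & size (expand ss') = L].
Proof.
elim: ss L => [|[i q] ss IH] L /=.
  by move=> _ L0; exists [::]; split=> //=; lia.
move=> /andP[/andP[/= q0 sq] ps]; rewrite expand_cons size_cat size_map => hL.
have le := size_expand ps.
(* The later blocks are filled first; this one takes the remainder, but keeps at least one vertex so
   that the visit survives. *)
pose t := maxn 1 (L - size (expand ss)).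
have sq0 : 0 < size q by case: q q0 {sq hL}.
have [||ss' [h1 h2 h3 h4]] := IH (L - t) => //; first by rewrite /t; lia.
have tq : t <= size q by rewrite /t; lia.
exists ((i, take t q) :: ss'); split=> /=.
- by rewrite h1.
- by rewrite h2 andbT /piece take_sorted //= -size_eq0 size_takel // andbT /t; lia.
- by rewrite !expand_cons; apply: cat_subseq => //; apply: map_subseq; apply: take_subseq.
- by rewrite expand_cons size_cat size_map size_takel // h4 /t; lia.
Qed.

(** The successive visits to layer [i] receive the successive members of [Q i]. *)
Lemma deal (W : seq nat) (Q : nat -> seq (seq H)) :
  (forall i, count_mem i W <= size (Q i)) ->
  exists2 ss, unzip1 ss = W &
    forall i, [seq x.2 | x <- ss & x.1 == i] = take (count_mem i W) (Q i).
Proof.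
elim: W Q => [|j W IH] Q hQ; first by exists [::] => // i; rewrite take0.
case EQ : (Q j) (hQ j) => [|q Qj] /=; first by rewrite eqxx.
move=> _; pose Q' i := if i == j then Qj else Q i.
have [|ss h1 h2] := IH Q'.
  move=> i; have := hQ i; rewrite /Q' /= (eq_sym j); case: eqP => [->|_] //=.
  by rewrite EQ /=; lia.
exists ((j, q) :: ss) => /=; first by rewrite h1.
move=> i; rewrite (eq_sym j); have := h2 i; rewrite /Q'; case: eqP => [->|_] /= ->.
  by rewrite EQ.
by rewrite add0n.
Qed.

Lemma count_expand ss i h :
  count_mem (i, h) (expand ss) =
  count_mem h (flatten [seq x.2 | x <- ss & x.1 == i]).
Proof.
elim: ss => [|[j q] ss IH] //=; rewrite expand_cons count_cat IH count_map.
case: eqP => [->|ne] /=.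
  rewrite count_cat; congr (_ + _); apply: eq_count => y /=.
  by rewrite xpair_eqE eqxx.
rewrite (eq_count (a2 := pred0)) ?count_pred0 // => y /=.
by rewrite xpair_eqE; apply/negP => /andP[/eqP].
Qed.

Lemma flatten_take (T : Type) (s : seq (seq T)) t :
  flatten s = flatten (take t s) ++ flatten (drop t s).
Proof. by rewrite -flatten_cat cat_take_drop. Qed.

(** Lengths between those of the walk and of its expansion come from [truncate]. The other clauses
    let the size of the expansion be estimated for a particular [Q]. *)
Lemma blow_up N (W : seq nat) (Q : nat -> seq (seq H)) :
  cycle stepn W -> all (fun i => i < N) W ->
  (forall i, count_mem i W <= size (Q i)) ->
  (forall i, all piece (Q i)) -> (forall i, uniq (flatten (Q i))) ->
  exists ss, [/\ unzip1 ss = W, pieces ss, uniq (expand ss),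
    (forall i, [seq x.2 | x <- ss & x.1 == i] = take (count_mem i W) (Q i)) &
    forall L, 2 < L -> size W <= L <= size (expand ss) ->
      has_cycle (lexprod (pathG N) H) L].
Proof.
move=> cW WN cQ pQ uQ; have [ss ssW ssQ] := deal cQ.
have ps : pieces ss.
  apply/allP => x xs; apply: (allP (pQ x.1)).
  apply: (@mem_take (count_mem x.1 W)); rewrite -ssQ.
  by apply: map_f; rewrite mem_filter eqxx.
have us : uniq (expand ss).
  apply: count_mem_uniq => -[i h].
  have u : uniq (flatten (take (count_mem i W) (Q i))).
    by have := uQ i; rewrite (flatten_take _ (count_mem i W)) cat_uniq => /andP[].
  rewrite -has_pred1 has_count count_expand ssQ.
  by rewrite count_uniq_mem //; case: (_ \in _).
exists ss; split=> // L L2; rewrite -ssW size_map => hL.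
have [ss' [h1 h2 h3 sL]] := truncate ps hL; rewrite -sL in L2 *.
apply: has_cycle_layers => //.
- exact: subseq_uniq h3 us.
- apply/allP => -[i h] /(mem_subseq h3) /flatten_mapP[x xs /mapP[h' _ [-> _]]] /=.
  by apply: (allP WN); rewrite -ssW map_f.
- by apply: expand_cycle => //; rewrite h1 ssW.
Qed.
End BlowUp.

(** * Orderings of the vertices of [H] and the edges between consecutive entries *)

Section Links.
Variable H : sgraph.

(** An ordering encodes the linear forest whose paths are its maximal stretches of successively
    adjacent vertices; these are the edges of that forest. *)
Fixpoint link_list (w : seq H) : seq {set H} :=
  if w is x :: w' then
    if w' is y :: _ then
      if adj x y then [set x; y] :: link_list w' else link_list w'
    else [::]
  else [::].

Lemma link_list_cons x y w : link_list [:: x, y & w] =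
  if adj x y then [set x; y] :: link_list (y :: w) else link_list (y :: w).
Proof. by []. Qed.

Definition links (w : seq H) := size (link_list w).

Lemma infix_consl (T : eqType) (x : T) s : infix s (x :: s).
Proof. by apply/infixP; exists [:: x], [::]; rewrite cats0. Qed.

Lemma links_le x w : links w <= links (x :: w).
Proof. by rewrite /links /=; case: w => //= y w; case: ifP. Qed.

Lemma links_cons x y w : links (x :: y :: w) = adj x y + links (y :: w).
Proof. by rewrite /links /=; case: ifP. Qed.

Lemma link_list_infix x y w : adj x y -> infix [:: x; y] w ->
  [set x; y] \in link_list w.
Proof.
move=> xy; case/infixP => s1 [s2 ->].
elim: s1 => [|z s1 IH] /=; first by rewrite xy mem_head.
case: (_ ++ _) IH => //= a b; case: ifP => // _; rewrite in_cons => ->.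
by rewrite orbT.
Qed.

Lemma links_lt w : w != [::] -> links w < size w.
Proof.
elim: w => [|x [|y w] IH] // _; rewrite links_cons.
by have := IH isT; rewrite /=; case: (adj _ _); lia.
Qed.

(** Cutting [w] wherever a link is missing gives [size w - links w] paths; cutting links as well
    raises the number one at a time, up to single vertices. *)
Lemma cut_pieces w a : size w - links w <= a <= size w ->
  exists2 Q, flatten Q = w & all (@piece H) Q /\ size Q = a.
Proof.
elim: w a => [|x [|y w] IH] a.
- by move=> /= h; exists [::] => //; split=> //=; lia.
- by move=> /= h; exists [:: [:: x]] => //; split=> //=; rewrite /links /= in h; lia.
have lt := links_lt (isT : y :: w != [::]).
rewrite links_cons => /= h; rewrite /= in lt.
(* The vertex [x] joins the next piece unless there is no link, or the tail is too short to supply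
   [a] pieces by itself. *)
have [/andP[xy aw]|na] := boolP (adj x y && (a <= (size w).+1)).
  have [|Q Qw [pQ sQ]] := IH a; first by rewrite /= xy in h *; lia.
  case: Q Qw pQ sQ => [|[|z q] Q] //= [zy Qw] /andP[sq pQ] sQ; subst z.
  exists ((x :: y :: q) :: Q) => /=; first by rewrite -Qw.
  by rewrite pQ andbT; split=> //; rewrite /piece /= xy.
have [|Q Qw [pQ sQ]] := IH a.-1.
  by rewrite /=; case: (adj x y) na h => /=; lia.
exists ([:: x] :: Q); first by rewrite /= Qw.
rewrite /= pQ sQ; split=> //.
by case: (adj x y) na h => /=; lia.
Qed.

Lemma mem_link_list w e : e \in link_list w ->
  exists x y, [/\ e = [set x; y], adj x y & infix [:: x; y] w].
Proof.
elim: w => [|x [|y w'] IH] //; rewrite link_list_cons; case: ifP => xy; rewrite ?in_cons.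
  case/orP => [/eqP ->|/IH[a [b [h1 h2 h3]]]].
    by exists x, y; split=> //; apply/infixP; exists [::], w'.
  by exists a, b; split=> //; apply: infix_trans h3 (infix_consl _ _).
case/IH => a [b [h1 h2 h3]]; exists a, b; split=> //.
exact: infix_trans h3 (infix_consl _ _).
Qed.

Lemma uniq_link_list w : uniq w -> uniq (link_list w).
Proof.
elim: w => [|x [|y w] IH] // /andP[xw /IH uw]; rewrite link_list_cons.
case: ifP => // xy; rewrite cons_uniq uw andbT.
apply: contra xw => /mem_link_list[a [b [e _ /mem_infix sub]]].
apply: sub; have : x \in [set a; b] by rewrite -e !inE eqxx.
by rewrite !inE.
Qed.

(** * The links of an ordering form a spanning linear forest *)

Section FromOrder.
Variables (w : seq H) (uw : uniq w) (w_all : forall x, x \in w).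
Let ix (x : H) := index x w.
Let F : {set {set H}} := [set e in link_list w].

Lemma infix_ix x y : infix [:: x; y] w = (ix y == (ix x).+1).
Proof.
apply/idP/eqP.
  case/infixP => s1 [s2 E]; move: uw; rewrite /ix E cat_uniq /=.
  rewrite !inE !negb_or => /and3P[_ /and3P[xs ys _] /andP[/andP[xy _] _]].
  by rewrite !index_cat (negbTE xs) (negbTE ys) /= !eqxx (negbTE xy) addn0 addn1.
move=> E; apply/infixP; exists (take (ix x) w), (drop (ix x).+2 w).
have yw : (ix x).+1 < size w by rewrite -E index_mem.
rewrite -{1}(cat_take_drop (ix x) w) (drop_nth x) ?index_mem //.
by rewrite (drop_nth x) // nth_index // -E nth_index.
Qed.

Lemma spanning_adjE (x y : H) : spanning_adj F x y =
  adj x y && ((ix y == (ix x).+1) || (ix x == (ix y).+1)).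
Proof.
rewrite /spanning_adj inE.
apply/andP/andP => [[xy /mem_link_list[a [b [e ab iab]]]]|[xy]].
  have : x \in [set a; b] by rewrite -e !inE eqxx.
  have : y \in [set a; b] by rewrite -e !inE eqxx orbT.
  rewrite infix_ix in iab; rewrite !inE.
  move=> /orP[]/eqP ?/orP[]/eqP ?; subst; rewrite ?eqxx // in xy *.
    by rewrite iab orbT adj_sym.
  by rewrite iab ab.
rewrite -!infix_ix => h; split.
  by apply: contraTneq xy => ->; rewrite adj_irr.
case/orP: h; first exact: link_list_infix.
by rewrite setUC; apply: link_list_infix; rewrite adj_sym.
Qed.

Lemma spanning_sub : F \subset edges H.
Proof.
apply/subsetP => e; rewrite !inE => /mem_link_list[x [y [-> xy _]]].
by apply/existsP; exists x; apply/existsP; exists y; rewrite xy eqxx.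
Qed.

Lemma ix_inj : injective ix.
Proof. by move=> x y /index_inj -> //. Qed.

Lemma connect_sym_spanning : connect_sym (spanning_adj F).
Proof. exact: sym_connect_sym (spanning_adj_sym F). Qed.

(* The vertex of largest position on a cycle would have two distinct
   neighbours at the preceding position. *)
Lemma spanning_forest : forest (spanning F).
Proof.
apply/forallP => l; apply/negP => /andP[l2 /existsP[[c /= /eqP sc] /andP[/= cc uc]]].
have [x xc xmax] : exists2 x : H, x \in c & forall y, y \in c -> ix y <= ix x.
  have [x0 hx] : exists x0 : H, x0 \in c.
    by case: c sc {cc uc} => [|x0 c] sc; [move: l2; rewrite -sc | exists x0; rewrite mem_head].
  by case: (arg_maxnP (fun y : H => ix y) hx) => x h1 h2; exists x.
have [i s Es] := rot_to xc.
have ccs : cycle (@adj (spanning F)) (x :: s) by rewrite -Es rot_cycle.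
have ucs : uniq (x :: s) by rewrite -Es rot_uniq.
have scs : size (x :: s) = l by rewrite -Es size_rot sc.
have mcs y : y \in x :: s -> ix y <= ix x by rewrite -Es mem_rot; apply: xmax.
case: s ccs ucs scs mcs {Es} => [|y s]; first by move=> _ _ /= e; rewrite -e in l2.
case/lastP: s => [|s z]; first by move=> _ _ /= e; rewrite -e in l2.
rewrite /= size_rcons.
rewrite rcons_path last_rcons !spanning_adjE => /and3P[/andP[_ h1] _ /andP[_ h2]].
rewrite !inE !mem_rcons !inE !negb_or => /and3P[_ /andP[yz _] _] _ m.
have := m y; have := m z; rewrite !inE !mem_rcons !inE !eqxx !orbT => /(_ isT) m1 /(_ isT) m2.
by case/negP: yz; apply/eqP/ix_inj; lia.
Qed.

(** Without a link from position [t] to the next one, the vertices at positions up to [t] are closed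
    under adjacency, so no connection passes beyond [t]. *)
Lemma connect_between (x y : H) t : connect (spanning_adj F) x y ->
  ix x <= t < ix y -> adj (nth x w t) (nth x w t.+1).
Proof.
move=> xy /andP[xt ty]; apply/negPn/negP => nt.
have cl : closed (spanning_adj F) [pred z | ix z <= t].
  apply: intro_closed => [|a b]; first exact: connect_sym_spanning.
  rewrite spanning_adjE !inE => /andP[ab h] a_t.
  case: (leqP (ix b) t) => // tb; case/negP: nt.
  have [ea eb] : t = ix a /\ t.+1 = ix b by lia.
  by rewrite eb ea !nth_index.
by have := closed_connect cl xy; rewrite !inE xt; lia.
Qed.

Lemma connect_links (x : H) d : ix x + d < size w ->
  (forall t, ix x <= t < ix x + d -> adj (nth x w t) (nth x w t.+1)) ->
  connect (spanning_adj F) x (nth x w (ix x + d)).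
Proof.
elim: d => [|d IH] lt h; first by rewrite addn0 nth_index.
apply: connect_trans (IH _ _) _; [lia|by move=> t ht; apply: h; lia|].
apply: connect1; rewrite spanning_adjE addnS h /=; last by lia.
have ixE j : j < size w -> ix (nth x w j) = j by move=> lj; apply: index_uniq.
by rewrite !ixE ?eqxx //; lia.
Qed.

Lemma connect_convex (x y z : H) : connect (spanning_adj F) x y ->
  ix x <= ix z <= ix y -> connect (spanning_adj F) x z.
Proof.
move=> xy h; have zw : ix z < size w by rewrite index_mem.
have E : ix x + (ix z - ix x) = ix z by lia.
have := @connect_links x (ix z - ix x); rewrite E nth_index //; apply=> // t ht.
by apply: connect_between xy _; lia.
Qed.

(** A component occupies an interval of positions; subtracting the least position maps it
    isomorphically onto a path. *)
Lemma spanning_component (x : spanning F) :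
  isomorphic (component x) (pathG #|component x|).
Proof.
have cs := connect_sym_spanning.
have [a xa amin] : exists2 a : H, connect (spanning_adj F) x a &
    forall y, connect (spanning_adj F) x y -> ix a <= ix y.
  by case: (arg_minnP (fun y : H => ix y) (connect0 (spanning_adj F) x)) => a h1 h2; exists a.
pose v (y : component x) : H := val y.
have aC (y : component x) : connect (spanning_adj F) a (v y).
  by have := valP y; rewrite inE; apply: connect_trans; rewrite cs.
have lo (y : component x) : ix a <= ix (v y).
  by apply: amin; have := valP y; rewrite inE.
(* All vertices positioned from [a] to [v y] lie in the component, so there are at most as many of
   them as its order. *)
have bound (y : component x) : ix (v y) - ix a < #|component x|.
  have ay := lo y; have yw : ix (v y) < size w by rewrite index_mem.
  pose s := [seq nth a w t | t <- iota (ix a) (ix (v y) - ix a).+1].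
  have ixE j : j < size w -> ix (nth a w j) = j by move=> lj; apply: index_uniq.
  have us : uniq s.
    rewrite map_inj_in_uniq ?iota_uniq // => i j; rewrite !mem_iota => hi hj.
    by move/(congr1 ix); rewrite !ixE //; lia.
  rewrite card_sig; have <- : size s = (ix (v y) - ix a).+1 by rewrite size_map size_iota.
  rewrite -(card_uniqP us); apply/subset_leq_card/subsetP => z /mapP[t].
  rewrite mem_iota => ht ->; rewrite !inE; apply: connect_trans xa _.
  by apply: connect_convex (aC y) _; rewrite ixE; lia.
pose f (y : component x) : pathG #|component x| := Ordinal (bound y).
have f_inj : injective f.
  move=> y z [e]; apply/val_inj/ix_inj; rewrite -!/(v _).
  by have := lo y; have := lo z; lia.
have [g fK gK] : bijective f by apply: inj_card_bij => //; rewrite card_ord.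
apply/existsP; exists [ffun y => f y]; apply/existsP; exists [ffun i => g i].
apply/and3P; split.
- by apply/forallP => y; rewrite !ffunE fK.
- by apply/forallP => y; rewrite !ffunE gK.
apply/forallP => y; apply/forallP => z; rewrite !ffunE.
have -> : adj y z = spanning_adj F (v y) (v z) by [].
have -> : adj (f y) (f z) =
    ((ix (v y) - ix a).+1 == ix (v z) - ix a) ||
    ((ix (v z) - ix a).+1 == ix (v y) - ix a) by [].
rewrite spanning_adjE; have ly := lo y; have lz := lo z.
(* The connection between consecutive positions has to cross at that very place, so they are
   linked. *)
have step (u u' : component x) : ix (v u') == (ix (v u)).+1 -> adj (v u) (v u').
  move=> /eqP e; have uv : connect (spanning_adj F) (v u) (v u').
    by apply: connect_trans (aC u'); rewrite cs.
  by have := connect_between uv (t := ix (v u)); rewrite -e !nth_index // e; apply; lia.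
have [/orP[] h|h] := boolP ((ix (v z) == (ix (v y)).+1) || (ix (v y) == (ix (v z)).+1)).
- by rewrite (step _ _ h); lia.
- by rewrite adj_sym (step _ _ h); lia.
- by rewrite andbF; lia.
Qed.

Lemma links_pi : links w <= pi_graph H.
Proof.
have -> : links w = #|F| by rewrite cardsE; apply/esym/card_uniqP/uniq_link_list.
apply: (leq_bigmax_cond (F := fun F : {set {set H}} => #|F|)).
rewrite spanning_sub /linear_forest spanning_forest /=.
exact/forallP/spanning_component.
Qed.

End FromOrder.

(** * Every spanning linear forest is contained in the links of some ordering *)

Lemma component_order (G : sgraph) (x : G) :
  isomorphic (component x) (pathG #|component x|) ->
  exists q, [/\ uniq q, q =i connect (@adj G) x &
    forall a b, connect (@adj G) x a -> adj a b -> infix [:: a; b] q || infix [:: b; a] q].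
Proof.
case/existsP => f /existsP[g /and3P[/forallP fK /forallP gK /forallP fadj]].
have g_inj : injective g by apply: (can_inj (g := f)) => i; apply/eqP.
pose v (y : component x) : G := val y.
have v_inj : injective v by exact: val_inj.
(* The inverse isomorphism carries the order of the path back to the component. *)
pose q := [seq v (g i) | i <- enum 'I_#|component x|].
have uq : uniq q by rewrite map_inj_uniq ?enum_uniq //; apply: inj_comp.
have memq : q =i connect (@adj G) x.
  move=> y; apply/mapP/idP => [[i _ ->]|xy].
    by have := valP (g i); rewrite inE.
  have xy' : y \in [set y | connect (@adj G) x y] by rewrite inE.
  exists (f (Sub y xy')); first by rewrite mem_enum.
  by rewrite (eqP (fK _)).
have infq (i j : 'I_#|component x|) : i.+1 = j -> infix [:: v (g i); v (g j)] q.
  move=> ij; apply/infixP; exists (take i q), (drop j.+1 q).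
  have sq : size q = #|component x| by rewrite size_map size_enum_ord.
  have nq (l : 'I_#|component x|) : nth x q l = v (g l).
    by rewrite (nth_map l) ?size_enum_ord // nth_ord_enum.
  rewrite -{1}(cat_take_drop i q) (drop_nth x) ?sq //.
  by rewrite ij (drop_nth x) ?sq // !nq.
exists q; split=> // a b xa ab.
have xb : connect (@adj G) x b := connect_trans xa (connect1 ab).
have xa' : a \in [set y | connect (@adj G) x y] by rewrite inE.
have xb' : b \in [set y | connect (@adj G) x y] by rewrite inE.
have := forallP (fadj (Sub a xa')) (Sub b xb').
have -> : adj (Sub a xa' : component x) (Sub b xb') by [].
move/eqP => /orP[]/eqP/infq; rewrite !(eqP (fK _)) => h; apply/orP; [left|right]; exact: h.
Qed.

(** The orders of the components are concatenated. Only an inequality results, since the ends of two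
    successive components may be adjacent in [H]. *)
Lemma linear_forest_order (F : {set {set H}}) :
  F \subset edges H -> linear_forest (spanning F) ->
  exists w : seq H, [/\ uniq w, forall x, x \in w & #|F| <= links w].
Proof.
move=> /subsetP sF /andP[_ /forallP iso].
pose e := spanning_adj F.
have cs : connect_sym e := sym_connect_sym (spanning_adj_sym F).
(* Components are represented by their roots, and [rs] lists those already placed. *)
have build (rs : seq H) : uniq rs -> all (fingraph.roots e) rs ->
  exists w, [/\ uniq w, forall y, (y \in w) = (fingraph.root e y \in rs) &
    forall a b, fingraph.root e a \in rs -> e a b -> infix [:: a; b] w || infix [:: b; a] w].
  elim: rs => [|r rs IH] /=; first by exists [::].
  move=> /andP[rrs /IH{}IH] /andP[rr /IH[w [uw mw iw]]].
  have [q [uq mq iq]] := component_order (iso r).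
  have mqr y : (y \in q) = (fingraph.root e y == r).
    rewrite mq -[_ \in _]/(connect e r y) -(root_connect cs) eq_sym.
    by rewrite (eqP (rr : fingraph.root e r == r)).
  exists (q ++ w); split.
  - rewrite cat_uniq uq uw andbT; apply/hasPn => y; rewrite mw /= mqr => yr.
    by apply: contraNneq rrs => <-.
  - by move=> y; rewrite mem_cat mqr mw in_cons.
  - move=> a b; rewrite in_cons => /orP[ra|ars] ab.
      rewrite -mqr mq in ra; case/orP: (iq a b ra ab) => h; apply/orP; [left|right];
        by apply: infix_trans h _; apply: prefixW; apply: prefix_prefix.
    case/orP: (iw a b ars ab) => h; apply/orP; [left|right];
      by apply: infix_trans h _; apply: suffixW; apply: suffix_suffix.
have [||w [uw mw iw]] := build (enum (fingraph.roots e)); first exact: enum_uniq.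
  by apply/allP => y; rewrite mem_enum.
have rin y : fingraph.root e y \in enum (fingraph.roots e) by rewrite mem_enum; apply: roots_root.
exists w; split=> //; first by move=> x; rewrite mw.
apply: leq_trans (card_size (link_list w)).
apply/subset_leq_card/subsetP => E EF; have := sF E EF.
rewrite inE => /existsP[x /existsP[y /andP[xy /eqP Exy]]].
have exy : e x y.
  by rewrite /e /spanning_adj -Exy EF andbT; apply: contraTneq xy => ->; rewrite adj_irr.
rewrite Exy; case/orP: (iw x y (rin x) exy) => h; first exact: link_list_infix.
by rewrite setUC; apply: link_list_infix; rewrite // adj_sym.
Qed.

Lemma pi_order :
  exists w : seq H, [/\ uniq w, forall x, x \in w & pi_graph H <= links w].
Proof.
rewrite /pi_graph; elim/big_ind: _ => [|m n [w1 [u1 a1 h1]] [w2 [u2 a2 h2]]|F /andP[]].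
- by exists (enum H); rewrite enum_uniq; split=> // x; rewrite mem_enum.
- by case: (leqP m n) => _; [exists w2 | exists w1].
- exact: linear_forest_order.
Qed.
End Links.

(** * Necessity: counting edges inside even layers *)

Section Necessity.
Variables (N : nat) (H : sgraph).
Implicit Types (i : 'I_N) (c : seq ('I_N * H)).

(** Different runs in one layer are concatenated; a link across a joint only increases [links],
    which is harmless for a lower bound on it. *)
Definition layer c i : seq H := [seq v.2 | v <- c & v.1 == i].

Lemma layer_cons v c i :
  layer (v :: c) i = if v.1 == i then v.2 :: layer c i else layer c i.
Proof. by rewrite /layer /=; case: ifP. Qed.

Lemma layer_links_mono v c i : links (layer c i) <= links (layer (v :: c) i).
Proof. by rewrite layer_cons; case: ifP => // _; apply: links_le. Qed.

(* Consecutive vertices in even layers lie in the same layer, so each maximal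
   run of such vertices contributes all its edges to one [links]; two runs are
   separated by a vertex in an odd layer. *)
Lemma even_layer_links c : sorted (@lex_adj (pathG N) H) c ->
  count (fun v : 'I_N * H => ~~ odd v.1) c <=
  \sum_(i < N | ~~ odd i) links (layer c i) + count (fun v : 'I_N * H => odd v.1) c
  + (if c is v :: _ then ~~ odd v.1 else false).
Proof.
elim: c => [|v c IH] //= pc; have {}IH := IH (path_sorted pc).
have mono : \sum_(i < N | ~~ odd i) links (layer c i) <=
            \sum_(i < N | ~~ odd i) links (layer (v :: c) i).
  by apply: leq_sum => i _; apply: layer_links_mono.
have [ov|ev] := boolP (odd v.1); first by case: c pc IH mono => [|u c] /= *; lia.
case: c pc IH mono => [|u c] /=; first by move=> *; lia.
case/andP => vu _ IH mono.
have [ou|eu] := boolP (odd u.1); first by rewrite ou /= in IH; lia.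
move: vu; rewrite /lex_adj /= /path_adj => /orP[|/andP[/eqP vu1 vu2]]; first by lia.
rewrite (negbTE eu) /= in IH.
set A := bigop.body _ _ _ in IH; set B := bigop.body _ _ _.
suff : A < B by lia.
rewrite {IH mono}/A /B.
rewrite (bigD1 v.1) //= [ltnRHS](bigD1 v.1) //= -addSn leq_add //.
  by rewrite !layer_cons -vu1 eqxx links_cons vu2.
by apply: leq_sum => i _; apply: layer_links_mono.
Qed.

End Necessity.

Lemma sum_odd n : \sum_(i < n) odd i = n./2.
Proof. by elim: n => [|n IH]; rewrite ?big_ord0 // big_ord_recr /= IH uphalf_half addnC. Qed.

Lemma sum_even n : \sum_(i < n) ~~ odd i = uphalf n.
Proof.
elim: n => [|n IH]; rewrite ?big_ord0 // big_ord_recr /= IH.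
by rewrite !uphalf_half; case: odd => /=; lia.
Qed.

Lemma count_layers N (H : finType) (P : pred nat) (c : seq ('I_N * H)) :
  uniq c -> (forall v, v \in c) ->
  count (fun v : 'I_N * H => P v.1) c = (\sum_(i < N) P i) * #|H|.
Proof.
move=> uc ac; rewrite -sum1_count big_mkcond /= big_uniq //=.
rewrite (eq_bigl xpredT) => [|v]; last exact: ac.
rewrite big_distrl /= -(pair_big xpredT xpredT (fun i h => if P (val i) then 1 else 0)) /=.
by apply: eq_bigr => i _; rewrite sum_nat_const; case: (P i); rewrite ?mul1n ?muln1 ?muln0.
Qed.

Lemma hamiltonian_bound k (H : sgraph) : 0 < k -> 0 < #|H| ->
  has_cycle (lexprod (pathG (2 * k + 1)) H) #|lexprod (pathG (2 * k + 1)) H| ->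
  #|H| <= (k + 1) * pi_graph H.
Proof.
set N := 2 * k + 1 => k0 H0 /andP[_ /existsP[[c /= /eqP sc] /andP[/= cc uc]]].
have ac (v : 'I_N * H) : v \in c.
  have /subset_cardP : #|c| = #|{: 'I_N * H}| by rewrite (card_uniqP uc) sc.
  by move/(_ (subset_predT _)) => ->.
have N1 : 1 < N by rewrite /N; lia.
have [h0 _] : exists h0 : H, h0 \in H by apply/card_gt0P.
(* Starting the cycle in layer 1, which is odd, makes the last term of [even_layer_links] vanish. *)
have [j s Es] := rot_to (ac (Ordinal N1, h0)).
have {}cc : path (@lex_adj (pathG N) H) (Ordinal N1, h0) s.
  by have := cc; rewrite -(rot_cycle j) Es /= rcons_path => /andP[].
have {}uc : uniq ((Ordinal N1, h0) :: s) by rewrite -Es rot_uniq.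
have {}ac v : v \in (Ordinal N1, h0) :: s by rewrite -Es mem_rot; apply: ac.
have := @even_layer_links N H ((Ordinal N1, h0) :: s) cc; rewrite addn0.
move: ((Ordinal N1, h0) :: s) uc ac => {sc cc Es}c' uc ac.
rewrite (count_layers (fun i => ~~ odd i)) // (count_layers odd) // sum_odd sum_even.
(* A Hamiltonian cycle meets each layer in an ordering of all of [H]. *)
have pil (i : 'I_N) : links (layer c' i) <= pi_graph H.
  apply: links_pi => [|x].
    rewrite map_inj_in_uniq ?filter_uniq // => -[a b] [a' b'] /=.
    by rewrite !mem_filter /= => /andP[/eqP -> _] /andP[/eqP -> _] ->.
  by apply/mapP; exists (i, x) => //; rewrite mem_filter eqxx ac.
have : \sum_(i < N | ~~ odd i) links (layer c' i) <= k.+1 * pi_graph H.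
  apply: (@leq_trans (\sum_(i < N | ~~ odd i) pi_graph H)); first exact: leq_sum.
  rewrite big_mkcond /= (eq_bigr (fun i : 'I_N => ~~ odd i * pi_graph H)); last first.
    by move=> i _; case: odd; rewrite ?mul1n.
  by rewrite -big_distrl /= sum_even leq_mul2r; apply/orP; right; rewrite /N; lia.
have -> : uphalf N = k.+1 by rewrite /N; lia.
have -> : N./2 = k by rewrite /N; lia.
(* With n = |H| this is (k+1) n <= (k+1) pi(H) + k n, and k n cancels. *)
move=> le1 /leq_trans/(_ (leq_add le1 (leqnn _))).
by rewrite mulSn leq_add2r addn1.
Qed.

(** * Sufficiency: cycles at least as long as the full closed walk, and shorter ones *)

Section Sufficiency.
Variables (k : nat) (H : sgraph) (w : seq H).
Hypotheses (k0 : 0 < k) (uw : uniq w) (aw : forall x, x \in w) (p0 : 0 < links w)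
  (hw : #|H| <= k.+1 * links w).

Let size_w : size w = #|H|.
Proof. by rewrite -(card_uniqP uw); apply: eq_card => x; rewrite aw. Qed.

Let p := links w.
Let m := size w - p.
Let f := mkseq (mult k p m) k.*2.

Let p_lt : p < size w.
Proof. by apply: links_lt; apply: contraTneq p0 => ->. Qed.

Let f_pos : all (leq 1) f.
Proof. by apply/allP => _ /mapP[i _ ->]; apply: mult_gt0; rewrite /m; lia. Qed.

Let count_f i : i <= k.*2 -> m <= count_mem i (tour 0 f) <= size w.
Proof.
move=> ik; rewrite count_tour // subn0 /=.
have -> : size w = m + p by rewrite /m; lia.
apply: mult_visits => //; rewrite /m ?size_w; last by rewrite leq_subLR -mulSn.
by have := p_lt; lia.
Qed.

Let count_f0 i : k.*2 < i -> count_mem i (tour 0 f) = 0.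
Proof.
move=> ik; apply/count_memPn; apply/negP => /(allP (tour_range 0 f)).
by rewrite size_mkseq; lia.
Qed.

(** In each layer, [w] is cut into exactly as many paths as there are visits, so the expansion is
    Hamiltonian and truncation gives the other lengths. *)
Lemma long_cycles L : 2 < L -> (sumn f).*2 <= L <= (2 * k + 1) * #|H| ->
  has_cycle (lexprod (pathG (2 * k + 1)) H) L.
Proof.
move=> L2 hL.
(* Beyond the last layer [size w] is merely a value that [cut_pieces] accepts. *)
pose a i := if i <= k.*2 then count_mem i (tour 0 f) else size w.
have exQ i : exists Q : seq (seq H), [&& flatten Q == w, all (@piece H) Q & size Q == a i].
  have [|Q e1 [e2 e3]] := @cut_pieces H w (a i).
    by rewrite /a; case: (leqP i) => [/count_f|_] //; rewrite leq_subr leqnn.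
  by exists Q; rewrite e1 e2 e3 !eqxx.
pose Q i := xchoose (exQ i).
have QP i := xchooseP (exQ i).
have [||||ss [ssW ps us ssQ cyc]] := @blow_up H (2 * k + 1) _ Q (cycle_tour 0 f).
- by apply: sub_all (tour_range 0 f) => i /=; rewrite size_mkseq; lia.
- move=> i; have /and3P[_ _ /eqP ->] := QP i; rewrite /a.
  by case: (leqP i k.*2) => // /count_f0 ->.
- by move=> i; have /and3P[_ -> _] := QP i.
- by move=> i; have /and3P[/eqP -> _ _] := QP i.
apply: cyc => //; rewrite size_tour //; case/andP: hL => -> /leq_trans -> //.
(* Every pair of a layer and a vertex of [H] occurs in the expansion, which bounds its size from
   below. *)
have := size_allpairs (fun (i : nat) (h : H) => (i, h)) (iota 0 (2 * k + 1)) (enum H).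
rewrite size_iota -cardE => <-; apply: uniq_leq_size.
  by apply: allpairs_uniq; rewrite ?iota_uniq ?enum_uniq // => -[? ?] [? ?] _ _ [-> ->].
move=> _ /allpairsP[[i h] /= [hi _ ->]]; rewrite mem_iota in hi.
rewrite -has_pred1 has_count count_expand ssQ take_oversize.
  by have /and3P[/eqP -> _ _] := QP i; rewrite -has_count has_pred1.
by have /and3P[_ _ /eqP ->] := QP i; rewrite /a ifT //; lia.
Qed.

(** A walk with [L./2] steps out and as many back has length [L] or [L.-1]; one visit widened to an
    edge supplies the missing vertex. *)
Lemma short_cycles L : 2 < L < (sumn f).*2 ->
  has_cycle (lexprod (pathG (2 * k + 1)) H) L.
Proof.
move=> /andP[L2 hL].
have [|s' [f' [f'0 sf' ef' cf' [j jW cj]]]] := @shrink_tour f 0 L./2 f_pos; first by lia.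
have [u [v uv]] : exists u v : H, adj u v.
  move: p0; rewrite /links; case E : (link_list w) => [|e l] // _.
  have /mem_link_list[u [v [_ uv _]]] : e \in link_list w by rewrite E mem_head.
  by exists u, v.
have uNv : u != v by apply: contraTneq uv => ->; rewrite adj_irr.
pose single := map (fun x : H => [:: x]).
have single_piece s : all (@piece H) (single s) by elim: s.
have flatten_single s : flatten (single s) = s by apply: flatten_seq1.
pose r := rem v (rem u w).
have vr : v \in rem u w by rewrite mem_rem_uniq // !inE eq_sym uNv aw.
have sr : (size r).+2 = size w.
  have : 1 < size w := leq_ltn_trans p0 p_lt.
  by rewrite /r !size_rem //; case: (size w) => [|[]].
(* Layer [j] now offers one piece fewer than [size w], enough because its visits have strictly
   dropped. The edge is put first so that it is certainly dealt. *)
pose Q i := if i == j then [:: u; v] :: single r else single w.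
have cw i : count_mem i (tour 0 f) <= size w.
  by case: (leqP i k.*2) => [/count_f/andP[]|/count_f0 ->].
have [||||ss [ssW ps us ssQ cyc]] := @blow_up H (2 * k + 1) _ Q (cycle_tour s' f').
- by apply: sub_all (tour_range s' f') => i /=; rewrite ef' size_mkseq; lia.
- move=> i; rewrite /Q; case: eqP => [->|_]; last by rewrite size_map (leq_trans (cf' i)).
  rewrite [size _]/= size_map -ltnS sr; exact: leq_trans cj (cw j).
- by move=> i; rewrite /Q; case: ifP => _ //=; rewrite single_piece /piece /= uv.
- move=> i; rewrite /Q; case: ifP => _; rewrite /= flatten_single //.
  by rewrite /r !inE !mem_rem_uniq ?rem_uniq // !inE !eqxx (negbTE uNv) /= mem_rem_uniq // !inE eqxx.
apply: cyc => //; rewrite size_tour // sf'; apply/andP; split; first by lia.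
(* As layer [j] is visited, the edge is used, and the expansion is strictly longer than the walk. *)
have : [:: u; v] \in [seq x.2 | x <- ss & x.1 == j].
  rewrite ssQ /Q eqxx; move: jW; rewrite -has_pred1 has_count.
  by case: (count_mem _ _) => //= n _; rewrite mem_head.
case/mapP => x; rewrite mem_filter => /andP[_ xss] Ex.
have := ltn_size_expand ps xss; rewrite -Ex => /(_ isT).
rewrite -(size_map fst) -/(unzip1 _) ssW size_tour // sf'; lia.
Qed.

End Sufficiency.

(** * The ceiling condition and the equivalence *)

Import GRing.Theory Num.Theory.

Lemma ceil_divn_le (n p c : nat) : 0 < p ->
  (Num.ceil (n%:R / p%:R : rat) <= c%:Z)%R = (n <= c * p).
Proof.
move=> p0; rewrite ceil_le_int ler_pdivrMr ?ltr0n // pmulrn -natrM ler_nat //.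
Qed.

Theorem theorem6 (k : nat) (hk : 1 <= k) (H : sgraph) (hH : 0 < #|H|) :
  pancyclic (lexprod (pathG (2 * k + 1)) H) <->
  1 <= pi_graph H /\
  (Num.ceil (#|H|%:R / (pi_graph H)%:R : rat) <= (k + 1)%:Z)%R.
Proof.
have cardG : #|lexprod (pathG (2 * k + 1)) H| = (2 * k + 1) * #|H|.
  by rewrite card_prod card_ord.
split=> [pan|[p0]].
  have le : #|H| <= (k + 1) * pi_graph H.
    by apply: hamiltonian_bound => //; apply: pan; rewrite leqnn andbT cardG; nia.
  (* If pi(H) were 0, the bound would make [H] empty. *)
  have p0 : 0 < pi_graph H by case: (pi_graph H) le => //; rewrite muln0; lia.
  by rewrite ceil_divn_le.
rewrite ceil_divn_le // addn1 => le L; rewrite cardG => /andP[L2 hL].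
have [w [uw aw pw]] := pi_order H.
have lew : #|H| <= k.+1 * links w by apply: leq_trans le _; rewrite leq_mul2l pw orbT.
have pw0 := leq_trans p0 pw.
(* The lengths split at that of the full closed walk. *)
have [lt|ge] := ltnP L (sumn (mkseq (mult k (links w) (size w - links w)) k.*2)).*2.
  by apply: (short_cycles (w := w)); rewrite ?L2.
by apply: (long_cycles (w := w)); rewrite ?ge.
Qed.
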